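(* Let $\mathbb W$, $C$ and $G$ be as in the context. Then $\operatorname{Inn}(\mathbb W)C$ is a normal subgroup of $\operatorname{Aut}(\mathbb W)$, $G$ is a subgroup with $\operatorname{Inn}(\mathbb W)C\cap G=1$, and $\operatorname{Aut}(\mathbb W)=\operatorname{Inn}(\mathbb W)C\,G$; that is, $$\operatorname{Aut}(\mathbb W)=\big(\operatorname{Inn}(\mathbb W)C\big)\rtimes G.$$
   Context: Fix an integer $n\ge 3$, pairwise distinct odd integers $m_1,\dots,m_l\ge 3$ and positive integers $k_1,\dots,k_l$ with $k_1+\cdots+k_l=n-1$. Partition $\{2,\dots,n\}$ into consecutive blocks $A_1=\{2,\dots,k_1+1\}$, $A_2=\{k_1+2,\dots,k_1+k_2+1\}$, …, $A_l$ (of sizes $k_1,\dots,k_l$), and put $t_i=m_j$ for $i\in A_j$. The star group is $\mathbb W=\langle w_1,\dots,w_n\mid w_j^2=1\ (1\le j\le n),\ (w_1w_i)^{t_i}=1\ (2\le i\le n)\rangle$. For $2\le i\le n$ and $1\le k<t_i$ with $\gcd(k,t_i)=1$, $\theta_i^k$ is the automorphism of $\mathbb W$ with $\theta_i^k(w_j)=w_j$ for $j\ne i$ and $\theta_i^k(w_i)=w_1(w_1w_i)^k$. Let $C_i=\langle\theta_i^k : 1\le k<t_i,\ \gcd(k,t_i)=1\rangle\cong \operatorname{U}_{t_i}$ and $C=C_2\times\cdots\times C_n\le\operatorname{Aut}(\mathbb W)$. $G$ is the group of graph automorphisms: the automorphisms $\tilde\alpha$ of $\mathbb W$ with $\tilde\alpha(w_1)=w_1$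 and $\tilde\alpha(w_i)=w_{\alpha(i)}$ ($2\le i\le n$), where $\alpha$ ranges over permutations of $\{2,\dots,n\}$ with $\alpha(A_j)=A_j$ for all $j$; $G\cong S_{k_1}\times\cdots\times S_{k_l}$. $\operatorname{Inn}(\mathbb W)$ is the group of inner automorphisms. *)

(* Defs.v *)
From HB Require Import structures.
From mathcomp Require Import all_boot.

Set Implicit Arguments.
Unset Strict Implicit.
Unset Printing Implicit Defensive.


(* Block index (0-based) of the position x (0-based) in the consecutive
   blocks of sizes ks. Position x = i - 2 corresponds to generator w_i. *)
Fixpoint blk (ks : seq nat) (x : nat) : nat :=
  match ks with
  | [::] => 0
  | k :: ks' => if x < k then 0 else (blk ks' (x - k)).+1
  end.

(* i is in block A_(j+1)  <->  blk ks (i - 2) = j ;  t_i = m_(blk+1). *)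
Definition tlab (ms ks : seq nat) (i : nat) : nat := nth 0 ms (blk ks (i - 2)).

Definition star_rel (n : nat) (t : nat -> nat) (H : groupType) (h : nat -> H)
  : Prop :=
  (forall j, 1 <= j <= n -> (h j * h j = 1)%g) /\
  (forall i, 2 <= i <= n -> ((h 1%N * h i) ^+ t i = 1)%g).

(* (W, w_1..w_n) is a presentation of the star group:
   the relations hold and the universal property of the presentation. *)
Definition is_star_group (n : nat) (t : nat -> nat) (W : groupType)
  (w : nat -> W) : Prop :=
  star_rel n t w /\
  (forall (H : groupType) (h : nat -> H), star_rel n t h ->
     exists f : W -> H, monoid_morphism f /\
       (forall j, 1 <= j <= n -> f (w j) = h j)) /\
  (forall (H : groupType) (f g : W -> H), monoid_morphism f ->
     monoid_morphism g -> (forall j, 1 <= j <= n -> f (w j) = g (w j)) ->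
     f =1 g).

Section Auts.
Variable W : groupType.

(* automorphisms of W, as functions (equality of automorphisms is =1) *)
Definition is_aut (f : W -> W) : Prop := monoid_morphism f /\ bijective f.

Definition inverse_of (f g : W -> W) : Prop := cancel f g /\ cancel g f.

Definition is_inner (f : W -> W) : Prop := exists u : W, forall x, f x = (x ^ u)%g.

Definition aut_subgroup (S : (W -> W) -> Prop) : Prop :=
  (forall f, S f -> is_aut f) /\
  S id /\
  (forall f g, S f -> S g -> S (f \o g)) /\
  (forall f g, S f -> inverse_of f g -> S g).

Definition aut_normal (S : (W -> W) -> Prop) : Prop :=
  aut_subgroup S /\
  (forall f a a', S f -> is_aut a -> inverse_of a a' -> S (a \o f \o a')).

Variables (n : nat) (t : nat -> nat) (w : nat -> W).

Definition is_theta (i k : nat) (f : W -> W) : Prop :=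
  is_aut f /\ f (w i) = (w 1%N * (w 1%N * w i) ^+ k)%g /\
  (forall j, 1 <= j <= n -> j != i -> f (w j) = w j).

(* C = C_2 x ... x C_n : the subgroup of Aut(W) generated by all theta_i^k *)
Inductive inC : (W -> W) -> Prop :=
  | inC_gen i k f : 2 <= i <= n -> 1 <= k < t i -> coprime k (t i) ->
      is_theta i k f -> inC f
  | inC_id f : f =1 id -> inC f
  | inC_comp f g h : inC f -> inC g -> h =1 f \o g -> inC h
  | inC_inv f g : inC f -> inverse_of f g -> inC g.

Definition inInnC (f : W -> W) : Prop :=
  exists a c, is_inner a /\ inC c /\ f =1 a \o c.

Variable ks : seq nat.

Definition is_graph_aut (f : W -> W) : Prop :=
  exists alpha : nat -> nat,
    (forall i, 2 <= i <= n -> 2 <= alpha i <= n /\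
                              blk ks (alpha i - 2) = blk ks (i - 2)) /\
    (forall i j, 2 <= i <= n -> 2 <= j <= n -> alpha i = alpha j -> i = j) /\
    (forall j, 2 <= j <= n -> exists2 i, 2 <= i <= n & alpha i = j) /\
    is_aut f /\ f (w 1) = w 1 /\
    (forall i, 2 <= i <= n -> f (w i) = w (alpha i)).

End Auts.

(* Main.v *)
(* Put rho_i = w_1 w_i. Then W is the semidirect product of the free product of
   the cyclic groups <rho_i> by <w_1>, which inverts every rho_i; normal forms
   follow from an action of W on reduced words. An involution outside the free
   product is ev s * w_1 with s a palindrome; since the middle letter of s is a
   square, the involution is conjugate to w_1. So after composing with an inner
   automorphism, f fixes w_1, and w_1 inverts f(rho_i), which is therefore again
   a palindrome. As it has finite order, its length is 1 and it is a power of
   some rho_(alpha i). The map f |-> alpha is multiplicative; its kernel is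
   Inn(W) C, and the graph automorphisms split it. *)
Require Import Defs.
From HB Require Import structures.
From mathcomp Require Import all_boot.
From mathcomp Require Import boolp.
From mathcomp Require Import perm zify.

Set Implicit Arguments.
Unset Strict Implicit.
Unset Printing Implicit Defensive.

Local Open Scope group_scope.

(** * The group of bijections of a type *)

Section Bijections.
Variable T : choiceType.

(** A bijection is stored with its inverse, so the group inverse is a swap. [T] may be infinite:
    below it is a set of words or two copies of W. *)
Definition bijp (p : (T -> T) * (T -> T)) : bool :=
  `[< cancel p.1 p.2 /\ cancel p.2 p.1 >].

Definition Bij := {p : (T -> T) * (T -> T) | bijp p}.
HB.instance Definition _ := Choice.on Bij.

Fact bij1_proof : bijp (id, id). Proof. exact/asboolP. Qed.
Fact bijV_proof (p : Bij) : bijp ((val p).2, (val p).1).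
Proof. by case: p => -[f g] /= /asboolP[fK gK]; apply/asboolP. Qed.
Fact bijM_proof (p q : Bij) :
  bijp ((val p).1 \o (val q).1, (val q).2 \o (val p).2).
Proof.
case: p q => -[f g] /= /asboolP[fK gK] [[f' g'] /= /asboolP[fK' gK']].
by apply/asboolP; split; apply: can_comp.
Qed.

Definition bij1 : Bij := Sub (id, id) bij1_proof.
Definition bijV (p : Bij) : Bij := Sub _ (bijV_proof p).
Definition bijM (p q : Bij) : Bij := Sub _ (bijM_proof p q).

Fact bijMA : associative bijM. Proof. by move=> p q r; apply: val_inj. Qed.
Fact bij1M : left_id bij1 bijM.
Proof. by move=> p; apply: val_inj; case: p => -[]. Qed.
Fact bijM1 : right_id bij1 bijM.
Proof. by move=> p; apply: val_inj; case: p => -[]. Qed.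
Fact bijVM : left_inverse bij1 bijV bijM.
Proof.
move=> -[[f g] fgP]; apply: val_inj => /=; have /asboolP[/= fK gK] := fgP.
by congr pair; apply/funext.
Qed.
Fact bijMV : right_inverse bij1 bijV bijM.
Proof.
move=> -[[f g] fgP]; apply: val_inj => /=; have /asboolP[/= fK gK] := fgP.
by congr pair; apply/funext.
Qed.

HB.instance Definition _ := isGroup.Build Bij bijMA bij1M bijM1 bijVM bijMV.

Definition bfun (p : Bij) : T -> T := (val p).1.

Lemma bfunM p q x : bfun (p * q) x = bfun p (bfun q x). Proof. by []. Qed.

Lemma bfun_inj p q : bfun p =1 bfun q -> p = q.
Proof.
case: p q => -[f g] fgP [[f' g'] fgP'] /= /funext; rewrite /bfun /= => ff'.
apply: val_inj => /=; move: fgP fgP' => /asboolP[/= fK gK] /asboolP[/= fK' gK'].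
rewrite -ff' in fK' gK' *; congr pair; apply/funext => x.
by rewrite -[in LHS](gK' x) fK.
Qed.

Lemma bfunX p k x : bfun (p ^+ k) x = iter k (bfun p) x.
Proof. by elim: k => //= k IHk; rewrite expgS bfunM IHk. Qed.

Definition invol_bij (f : T -> T) (fK : involutive f) : Bij :=
  Sub (f, f) (introT (asboolP _) (conj fK fK)).

End Bijections.

(** * Homomorphisms and powers *)

Section Morphisms.
Variables (G H : groupType) (f : G -> H).
Hypothesis fM : monoid_morphism f.
HB.instance Definition _ := isUMagmaMorphism.Build G H f fM.

Lemma morX k : {morph f : x / x ^+ k}. Proof. exact: gmulfXn. Qed.
Lemma morV : {morph f : x / x^-1}. Proof. exact: gmulfV. Qed.
Lemma morJ : {morph f : x y / x ^ y}. Proof. exact: gmulfJ. Qed.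
End Morphisms.

Lemma mor_comp (G H K : groupType) (f : H -> K) (g : G -> H) :
  monoid_morphism f -> monoid_morphism g -> monoid_morphism (f \o g).
Proof.
by move=> fM gM; split=> [|x y] /=; rewrite ?gM.1 ?fM.1 // gM.2 fM.2.
Qed.

Lemma morJr (G : groupType) (u : G) : monoid_morphism (conjg ^~ u).
Proof. by split=> [|x y]; rewrite ?conj1g ?conjMg. Qed.

Lemma expg_mod (G : groupType) (x : G) m k : x ^+ m = 1 -> x ^+ (k %% m) = x ^+ k.
Proof. by move=> xm; rewrite [in RHS](divn_eq k m) expgnDr mulnC expgnA xm expg1n mul1g. Qed.

(** * Relations, generation and parity in W *)

Section StarGroup.
Variables (n : nat) (t : nat -> nat) (W : groupType) (w : nat -> W).
Hypothesis n_gt2 : 2 < n.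
Hypothesis t_odd : forall i, 2 <= i <= n -> odd (t i) && (2 < t i).
Hypothesis presW : is_star_group n t w.

Definition rho i := w 1 * w i.

Let relW := presW.1.

Lemma ww j : 1 <= j <= n -> w j * w j = 1. Proof. exact: relW.1. Qed.

Lemma w1w1 : w 1 * w 1 = 1. Proof. by apply: ww; lia. Qed.

Lemma w1V : (w 1)^-1 = w 1. Proof. exact: (mulg1_eq w1w1). Qed.

Lemma wE i : w i = w 1 * rho i. Proof. by rewrite /rho mulgA w1w1 mul1g. Qed.

Lemma rho_torsion i : 2 <= i <= n -> rho i ^+ t i = 1. Proof. exact: relW.2. Qed.

Lemma rhoJ i : 2 <= i <= n -> rho i ^ w 1 = (rho i)^-1.
Proof.
move=> i_in; rewrite /rho invgM conjgE w1V !mulgA w1w1 mul1g.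
by congr (_ * _); symmetry; apply: mulg1_eq; apply: ww; lia.
Qed.

Lemma star_hom (H : groupType) (h : nat -> H) : star_rel n t h ->
  exists2 f : W -> H, monoid_morphism f & forall j, 1 <= j <= n -> f (w j) = h j.
Proof. by move=> /(presW.2.1 H h)[f [fM fE]]; exists f. Qed.

Lemma star_ext (H : groupType) (f g : W -> H) :
  monoid_morphism f -> monoid_morphism g -> f (w 1) = g (w 1) ->
  (forall i, 2 <= i <= n -> f (rho i) = g (rho i)) -> f =1 g.
Proof.
move=> fM gM fg1 fgx; apply: presW.2.2 => // j j_in.
have [->|j1] := eqVneq j 1%N; first exact: fg1.
by rewrite wE fM.2 gM.2 fg1 fgx //; lia.
Qed.

(* Two copies of W glued along P carry two left actions of W, which agree on
   the generators, hence everywhere. *)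
Lemma gen_subgroup (P : W -> Prop) : P 1 -> (forall y z, P y -> P z -> P (y * z)) ->
  (forall y, P y -> P y^-1) -> (forall j, 1 <= j <= n -> P (w j)) -> forall y, P y.
Proof.
move=> P1 PM PV Pw.
pose lm (y : W) (z : W * bool) := (y * z.1, z.2).
have lmK y : cancel (lm y) (lm y^-1) by move=> [z b]; rewrite /lm /= mulKg.
have lmKV y : cancel (lm y^-1) (lm y) by move=> [z b]; rewrite /lm /= mulVKg.
pose L y : Bij (W * bool)%type :=
  Sub (lm y, lm y^-1) (introT (asboolP _) (conj (lmK y) (lmKV y))).
have LM : monoid_morphism L.
  split=> [|y z]; apply: bfun_inj => -[v b]; rewrite /bfun /= /lm /=.
    by rewrite mul1g.
  by rewrite mulgA.
(* [gl] exchanges the two copies exactly over [P]. Conjugation by it preserves the action of each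
   generator, as P z and P (w_j z) are equivalent. *)
pose gl (z : W * bool) := (z.1, z.2 (+) `[< P z.1 >]).
have glK : involutive gl by move=> [z b]; rewrite /gl /= addbK.
have LJ := mor_comp (morJr (invol_bij glK)) LM.
have LE : L =1 conjg ^~ (invol_bij glK) \o L.
  apply: presW.2.2 => // j j_in; apply: bfun_inj => -[z b].
  rewrite /bfun /= /lm /gl /=.
  suff ->: `[< P (w j * z) >] = `[< P z >] by rewrite addbK.
  apply/asbool_equiv_eq; split=> [Pwz|]; last by apply: PM; apply: Pw.
  by rewrite -(mulKg (w j) z); apply: PM => //; apply/PV/Pw.
(* One action sends the point (1, true) to the copy [true], the other sends it to the copy given by
   the truth value of P y. *)
move=> y; have /(congr1 (fun p => (bfun p (1, true)).2)) := LE y.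
rewrite /bfun /= /lm /= mulg1; case: asboolP => //=.
by case: (asboolP (P y)).
Qed.

Lemma gen_ind (P : W -> Prop) : P 1 -> (forall j y, 1 <= j <= n -> P y -> P (w j * y)) ->
  forall y, P y.
Proof.
move=> P1 Pw y.
(* [P] need not be closed under products, but the y such that left multiplication by y and by y^-1
   preserves [P] form a subgroup. *)
suff: (forall z, P z -> P (y * z)) /\ (forall z, P z -> P (y^-1 * z)).
  by case=> /(_ 1 P1); rewrite mulg1.
elim/gen_subgroup: y => [|y z [Py Py'] [Pz Pz']|y [Py Py']|j j_in].
- by rewrite invg1; split=> z; rewrite mul1g.
- split=> v Pv; rewrite ?invgM -mulgA.
    by apply/Py/Pz.
  by apply/Pz'/Py'.
- by rewrite invgK.
- have ->: (w j)^-1 = w j by apply: mulg1_eq; apply: ww.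
  by split=> z; apply: Pw.
Qed.

(** All relators have even length, so every [w j] may go to the transposition of two points. As each
    rho_i is even, parity detects the factor [w 1] in a normal form. *)
Lemma parity_exists : exists e : W -> bool,
  {morph e : y z / y * z >-> y (+) z} /\ forall j, 1 <= j <= n -> e (w j).
Proof.
pose tau : {perm bool} := tperm true false.
have tau2 : (tau * tau = 1)%g by apply: tperm2.
have [|f fM fw] := @star_hom {perm bool} (fun=> tau).
  by split=> [//|i _]; rewrite tau2 expg1n.
exists (fun y => odd_perm (f y)); split=> [y z|j j_in].
  by rewrite fM.2 odd_permM.
by rewrite fw // odd_tperm.
Qed.

(** * Reduced words and the action of W on them *)

(* A letter (i, a) stands for rho_i^a. *)
Definition letter (p : nat * nat) := (2 <= p.1 <= n) && (0 < p.2 < t p.1).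
Definition apart (p q : nat * nat) := p.1 != q.1.
Definition reduced s := all letter s && sorted apart s.
Definition fresh i (s : seq (nat * nat)) := if s is p :: _ then p.1 != i else true.

(** Inversion of a letter with its exponent kept in range; on words [flip] is conjugation by
    [w 1]. *)
Definition flipl (p : nat * nat) := (p.1, t p.1 - p.2).
Definition flip := map flipl.

(** These serve to define [push i], left multiplication by rho_i on reduced words: it raises the
    exponent of a leading letter with index i, and the letter vanishes when the exponent reaches
    t_i. *)
Definition attach i a s : seq (nat * nat) := if a == 0 then s else (i, a) :: s.
Definition lead i (s : seq (nat * nat)) :=
  if s is p :: _ then if p.1 == i then p.2 else 0 else 0.
Definition trail i (s : seq (nat * nat)) :=
  if s is p :: s' then if p.1 == i then s' else s else s.
Definition push i s :=
  attach i (if (lead i s).+1 == t i then 0 else (lead i s).+1) (trail i s).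

Arguments push : simpl never.

Lemma reduced_cons p s : reduced (p :: s) = [&& letter p, fresh p.1 s & reduced s].
Proof.
rewrite /reduced /=; case: s => [|q s] /=; first by rewrite !andbT.
by rewrite /apart eq_sym; case: (letter p) => //=; rewrite andbCA.
Qed.

Lemma reduced_letters s : reduced s -> all letter s. Proof. by case/andP. Qed.

Lemma fliplK p : letter p -> flipl (flipl p) = p.
Proof. by case: p => i a /andP[/= _ /andP[a0 at']]; rewrite /flipl /=; congr pair; lia. Qed.

Lemma letter_flip p : letter p -> letter (flipl p).
Proof. by case: p => i a; rewrite /letter /= => /andP[-> /= /andP[a0 at']]; lia. Qed.

Lemma flipK s : all letter s -> flip (flip s) = s.
Proof. by elim: s => //= p s IHs /andP[lp ls]; rewrite fliplK // IHs. Qed.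

Lemma fresh_flip i s : fresh i (flip s) = fresh i s. Proof. by case: s. Qed.

Lemma reduced_flip s : reduced s -> reduced (flip s).
Proof.
elim: s => //= p s IHs; rewrite !reduced_cons => /and3P[lp fs rs].
by rewrite letter_flip //= fresh_flip fs IHs.
Qed.

Lemma push_fresh i s : 2 <= i <= n -> fresh i s -> push i s = (i, 1%N) :: s.
Proof.
move=> /t_odd ti; case: s => [|p s] fs; rewrite /push /=.
  by rewrite (_ : (1%N == t i) = false) //; lia.
by rewrite (negbTE fs) (_ : (1%N == t i) = false) //; lia.
Qed.

Lemma push_cons i a s :
  push i ((i, a) :: s) = if a.+1 == t i then s else (i, a.+1) :: s.
Proof. by rewrite /push /= eqxx; case: (a.+1 == t i). Qed.

Lemma reduced_push i s : 2 <= i <= n -> reduced s -> reduced (push i s).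
Proof.
move=> i_in; have ti := t_odd i_in; have [fs rs|] := boolP (fresh i s).
  by rewrite push_fresh // reduced_cons fs rs /letter /= i_in; lia.
case: s => [//|[j a] s] /= /negPn/eqP-> {j}; rewrite push_cons !reduced_cons.
case/and3P=> /andP[_ /= la] fs rs; case: ifP => // /eqP at'.
by rewrite reduced_cons fs rs /letter /= i_in; lia.
Qed.

(** As w_i = w_1 rho_i acts by [push i] followed by [flip], this is the relation w_i^2 = 1. *)
Lemma flip_pushK i s : 2 <= i <= n -> reduced s -> flip (push i (flip (push i s))) = s.
Proof.
move=> i_in; have ti := t_odd i_in; have [fs rs|] := boolP (fresh i s).
  rewrite (push_fresh i_in fs) /= /flipl /= push_cons.
  by rewrite (_ : (t i - 1%N).+1 == t i) ?flipK ?reduced_letters //; lia.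
case: s => [//|[j a] s] /= /negPn/eqP-> {j}; rewrite push_cons !reduced_cons.
case/and3P=> /andP[_ /= la] fs rs; case: eqP => at'.
  rewrite push_fresh ?fresh_flip //= /flipl /= flipK ?reduced_letters //.
  by congr (_ :: _); congr pair; lia.
rewrite /= /flipl /= push_cons; case: eqP => at''; first by lia.
rewrite /= /flipl /= flipK ?reduced_letters //.
by congr (_ :: _); congr pair; lia.
Qed.

Lemma iter_push i s a : 2 <= i <= n -> fresh i s -> 0 < a < t i ->
  iter a (push i) s = (i, a) :: s.
Proof.
move=> i_in fs; elim: a => // -[|a] IHa la; first by rewrite /= push_fresh.
by rewrite iterS IHa ?push_cons; [case: eqP => //; lia | lia].
Qed.

(** A word with first letter (i, a) is obtained from its tail by a pushes. These commute with the
    t_i pushes, so the case of a fresh word suffices. *)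
Lemma iter_push_t i s : 2 <= i <= n -> reduced s -> iter (t i) (push i) s = s.
Proof.
move=> i_in; have ti := t_odd i_in.
have fresh_case s' : fresh i s' -> iter (t i) (push i) s' = s'.
  move=> fs; rewrite -(@prednK (t i)) ?iterS ?iter_push ?push_cons //; try lia.
  by case: eqP => //; lia.
have [fs rs|] := boolP (fresh i s); first exact: fresh_case.
case: s => [//|[j a] s] /= /negPn/eqP-> {j}; rewrite reduced_cons.
case/and3P=> /andP[_ /= la] fs rs.
by rewrite -iter_push // -iterD addnC iterD fresh_case.
Qed.

(** Extension by the identity makes an involution on reduced words a bijection of all lists. *)
Definition onreduced F s : seq (nat * nat) := if reduced s then F s else s.

Lemma onreduced_invol F :
  (forall s, reduced s -> reduced (F s)) -> (forall s, reduced s -> F (F s) = s) ->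
  involutive (onreduced F).
Proof.
move=> Fred FK s; rewrite /onreduced; case: (boolP (reduced s)) => [rs|/negbTE-> //].
by rewrite Fred // FK.
Qed.

Lemma flip_invol : involutive (onreduced flip).
Proof.
by apply: onreduced_invol => s rs; [apply: reduced_flip | rewrite flipK ?reduced_letters].
Qed.

(** The involutions [flip] for w_1 and [flip \o push i] for w_i satisfy the relations, so the
    presentation turns them into an action. *)
Lemma word_action : exists act : W -> seq (nat * nat) -> seq (nat * nat),
  [/\ act 1 =1 id, forall y z s, act (y * z) s = act y (act z s)
    & forall i s, 2 <= i <= n -> reduced s -> act (rho i) s = push i s].
Proof.
have hP i : exists b : Bij (seq (nat * nat)), b * b = 1 /\
    (2 <= i <= n -> bfun b =1 onreduced (flip \o push i)).
  have [i_in|_] := boolP (2 <= i <= n); last by exists 1; rewrite mulg1.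
  have bK : involutive (onreduced (flip \o push i)).
    apply: onreduced_invol => s rs; first exact/reduced_flip/reduced_push.
    exact: flip_pushK.
  by exists (invol_bij bK); split=> //; apply: bfun_inj => s; apply: bK.
have [h hE] := choice hP.
pose h' i := if i == 1%N then invol_bij flip_invol else h i.
have h'E i s : 2 <= i <= n -> reduced s -> bfun (h' 1%N * h' i) s = push i s.
  move=> i_in rs; rewrite /h' /=; case: eqP => [i1|_]; first by lia.
  rewrite bfunM (hE i).2 // /onreduced rs /= /bfun /= /onreduced.
  rewrite reduced_flip ?reduced_push // flipK //.
  exact/reduced_letters/reduced_push.
have h'r : star_rel n t h'.
  split=> [j _|i i_in].
    rewrite /h'; case: eqP => _; last exact: (hE j).1.
    by apply: bfun_inj => s; apply: flip_invol.
  apply: bfun_inj => s; rewrite bfunX.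
  have [rs|nrs] := boolP (reduced s).
    rewrite -[RHS](iter_push_t i_in rs); move: (t i) => m.
    suff: reduced (iter m (push i) s) /\
      iter m (bfun (h' 1%N * h' i)) s = iter m (push i) s by case.
    elim: m => //= m [rm ->]; rewrite h'E //; split=> //.
    exact: reduced_push.
  (* The generators fix every list that is not reduced, so the relation is trivial there. *)
  have fixs : bfun (h' 1%N * h' i) s = s.
    rewrite bfunM /h' /=; case: eqP => [i1|_]; first by lia.
    by rewrite (hE i).2 // /onreduced (negbTE nrs) /bfun /= /onreduced (negbTE nrs).
  by elim: (t i) => //= m ->.
have [f fM fE] := star_hom h'r.
exists (fun y => bfun (f y)); split=> [s|y z s|i s i_in rs].
- by rewrite fM.1.
- by rewrite fM.2.
- by rewrite fM.2 !fE ?h'E //; lia.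
Qed.

(** * Evaluation of words and normal forms *)

Fixpoint ev (s : seq (nat * nat)) : W := if s is p :: s' then rho p.1 ^+ p.2 * ev s' else 1.

Lemma ev_cat s1 s2 : ev (s1 ++ s2) = ev s1 * ev s2.
Proof. by elim: s1 => [|p s IHs] /=; rewrite ?mul1g // IHs mulgA. Qed.

(** The action of [ev s] on the empty word returns s. *)
Lemma ev_inj s1 s2 : reduced s1 -> reduced s2 -> ev s1 = ev s2 -> s1 = s2.
Proof.
have [act [act1 actM actx]] := word_action.
suff actE s : reduced s -> act (ev s) [::] = s.
  by move=> r1 r2 e12; rewrite -(actE s1) // e12 actE.
elim: s => [_|[i a] s IHs] /=; first by rewrite act1.
rewrite reduced_cons => /and3P[/andP[/= i_in la] fs rs].
rewrite actM IHs // -iter_push //.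
have: reduced (iter a (push i) s) /\ act (rho i ^+ a) s = iter a (push i) s.
  elim: a {la} => [|a [ra actE]]; first by rewrite act1.
  by rewrite expgS actM actE iterS actx //; split=> //; apply: reduced_push.
by case.
Qed.

Lemma ev_push i s : 2 <= i <= n -> ev (push i s) = rho i * ev s.
Proof.
move=> i_in; have [fs|] := boolP (fresh i s); first by rewrite push_fresh.
case: s => [//|[j a] s] /= /negPn/eqP-> {j}; rewrite push_cons mulgA -expgS.
by case: eqP => //= ->; rewrite rho_torsion // mul1g.
Qed.

Lemma ev_flip s : all letter s -> ev (flip s) = ev s ^ w 1.
Proof.
elim: s => [|[i a] s IHs] /=; first by rewrite conj1g.
move=> /andP[/andP[/= i_in la] /IHs->]; rewrite conjMg conjXg rhoJ //.
congr (_ * _); rewrite expgnFr ?rho_torsion //; last by lia.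
by rewrite expVgn mul1g.
Qed.

Lemma ev_rev_flip s : all letter s -> ev (rev (flip s)) = (ev s)^-1.
Proof.
elim: s => [|[i a] s IHs] /=; first by rewrite invg1.
move=> /andP[/andP[/= i_in la] /IHs evs].
rewrite rev_cons -cats1 ev_cat evs /= mulg1 invgM.
by congr (_ * _); rewrite expgnFr ?rho_torsion ?mul1g //; lia.
Qed.

(** Multiplying by w_j = w_1 rho_j on the left pushes a letter; then [w 1] moves to the right end of
    the word and flips it on the way. *)
Lemma normal_form y : exists s b, reduced s /\ y = ev s * w 1 ^+ (b : bool).
Proof.
elim/gen_ind: y => [|j y j_in [s [b [rs ->]]]].
  by exists [::], false; rewrite mulg1.
have w1ev s' : reduced s' -> w 1 * ev s' = ev (flip s') * w 1.
  move=> rs'; rewrite ev_flip ?reduced_letters // conjgE w1V -!mulgA w1w1.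
  by rewrite mulg1.
have w1b : w 1 * w 1 ^+ b = w 1 ^+ (~~ b).
  by case: (b) => /=; rewrite ?expg1 ?expg0 ?w1w1 ?mulg1.
have [->|j1] := eqVneq j 1%N.
  exists (flip s), (~~ b); split; first exact: reduced_flip.
  by rewrite mulgA w1ev // -mulgA w1b.
have j_in2 : 2 <= j <= n by lia.
exists (flip (push j s)), (~~ b); split; first exact/reduced_flip/reduced_push.
rewrite wE -mulgA (mulgA (rho j)) -ev_push // mulgA w1ev ?reduced_push //.
by rewrite -mulgA w1b.
Qed.

Lemma rhoX_eq1 i k : 2 <= i <= n -> rho i ^+ k = 1 -> t i %| k.
Proof.
move=> i_in; rewrite -(expg_mod k (rho_torsion i_in)) => xk1; have ti := t_odd i_in.
rewrite /dvdn; have [//|k0] := eqVneq (k %% t i) 0.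
have: [:: (i, k %% t i)] = [::]; last by [].
apply: ev_inj => //=; last by rewrite xk1 mulg1.
by rewrite reduced_cons /letter /= i_in /= lt0n k0 ltn_mod andbT /=; lia.
Qed.

(** * Palindromes *)

Lemma reduced_rev s : reduced s -> reduced (rev s).
Proof.
rewrite /reduced all_rev rev_sorted => /andP[-> /=].
by rewrite (eq_sorted (e' := apart)) // => p q; rewrite /apart eq_sym.
Qed.

Lemma rho_neq1 i : 2 <= i <= n -> rho i <> 1.
Proof.
move=> i_in xi1; have: t i %| 1%N by apply: rhoX_eq1; rewrite // expg1.
by have := t_odd i_in; rewrite dvdn1; lia.
Qed.

Lemma rho_square i a : 2 <= i <= n -> exists k, rho i ^+ a = rho i ^+ k * rho i ^+ k.
Proof.
(* (t_i + 1)/2 is the inverse of 2 modulo the odd number t_i. *)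
move=> i_in; have ti := t_odd i_in; exists (a * (t i).+1./2)%N.
rewrite -expgnDr -mulnDr addnn (_ : ((t i).+1./2).*2 = (t i).+1); last by lia.
by rewrite mulnS expgnDr mulnC expgnA rho_torsion // expg1n mulg1.
Qed.

(** Conjugation by [w 1] flips the letters, while inversion flips and reverses them; by uniqueness
    of reduced words the two results coincide letter by letter. *)
Lemma inverted_palindrome s : reduced s -> ev s ^ w 1 = (ev s)^-1 -> rev s = s.
Proof.
move=> rs sJ; have /reduced_letters ls := rs.
have: flip s = rev (flip s).
  by apply: ev_inj; rewrite ?reduced_rev ?reduced_flip // ev_flip // ev_rev_flip.
by move/(congr1 flip); rewrite /flip map_rev -/flip flipK.
Qed.

(* The middle letter is a square, as t_i is odd, and w_1 inverts each rho_i. *)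
Lemma palindrome_conj s : all letter s -> rev s = s -> exists y, ev s * w 1 = w 1 ^ y.
Proof.
have [m] := ubnP (size s); elim: m s => // m IHm [|[i a] s] /= sz.
  by move=> _ _; exists 1; rewrite mul1g conjg1.
case/andP=> /andP[/= i_in _].
(* Since z w_1 = w_1 z^-1, the equal outer letters of a palindrome become a conjugation of the inner
   part times w_1. *)
have conjV z y : z ^ w 1 = z^-1 -> z * y * z * w 1 = (y * w 1) ^ z^-1.
  move=> zw; rewrite conjgE invgK !mulgA -!(mulgA (z * y)); congr (_ * _).
  by rewrite -zw conjgE w1V !mulgA w1w1 mul1g.
have xkJ k : (rho i ^+ k) ^ w 1 = (rho i ^+ k)^-1 by rewrite conjXg rhoJ // expVgn.
case/lastP: s sz => [|s [j b]] sz ls.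
  have [k ->] := rho_square a i_in; move=> _; exists (rho i ^+ k)^-1.
  by have := conjV _ 1 (xkJ k); rewrite !mulg1 mul1g.
rewrite rev_cons rev_rcons /= => -[ji ba]; subst j b; move=> /rcons_inj[rs].
have [||y yE] := IHm s _ _ rs.
- by rewrite size_rcons in sz; lia.
- by move: ls; rewrite all_rcons => /andP[].
exists (y * (rho i ^+ a)^-1).
by rewrite -cats1 ev_cat /= mulg1 mulgA conjV // yE conjgM.
Qed.

(* Conjugating an odd palindrome of length > 1 by its first letter makes it
   cyclically reduced, because t_i is odd. *)
Lemma palindrome_torsion s m : reduced s -> rev s = s -> 0 < m -> ev s ^+ m = 1 -> size s <= 1.
Proof.
case: s => [|[i a] s] //; case/lastP: s => [|s [j b]] //.
rewrite rev_cons rev_rcons /= => + [ji ba] + m0; subst j b.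
case: s => [|p s]; first by rewrite reduced_cons /= eqxx andbF.
set v := p :: s; rewrite reduced_cons => /and3P[li fi rv] /rcons_inj[revv].
have /andP[/= i_in la] := li; have ti := t_odd i_in.
(* Conjugation merges the first and last letters into one of exponent 2a, which is nonzero modulo
   t_i because t_i is odd and 0 < a < t_i. *)
pose d := (2 * a) %% t i.
have d0 : d != 0.
  apply/negP; rewrite -/(t i %| 2 * a) Gauss_dvdr; last by rewrite coprimen2; case/andP: ti.
  by move/dvdn_leq; lia.
have ld : letter (i, d) by rewrite /letter /= i_in lt0n d0 ltn_mod; lia.
have evd : ev (rcons v (i, d)) = ev (rcons ((i, a) :: v) (i, a)) ^ (rho i ^+ a).
  rewrite -!cats1 !ev_cat /= !mulg1 /d expg_mod ?rho_torsion // mul2n -addnn expgnDr.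
  by rewrite conjgE !mulgA mulVg mul1g.
have rvd : reduced (rcons v (i, d)).
  move: (rv); rewrite -[rcons v (i, a)]revK -[rcons v (i, d)]revK !rev_rcons.
  move/reduced_rev; rewrite revK reduced_cons => /and3P[_ fv rv'].
  by apply: reduced_rev; rewrite reduced_cons ld fv.
move=> evm; have: ev (rcons v (i, d)) ^+ m = 1 by rewrite evd -conjXg evm conj1g.
(* The second conjunct makes the junctions reduced: each factor ends in a letter of index i, and the
   next one starts with another index. *)
have rpow k : reduced (flatten (nseq k.+1 (rcons v (i, d)))) &&
              fresh i (flatten (nseq k.+1 (rcons v (i, d)))).
  elim: k => [|k /andP[rk fk]]; first by rewrite /= cats0 rvd /=.
  move: rk fk; rewrite -[flatten (nseq k.+2 _)]/(rcons v (i, d) ++ flatten (nseq k.+1 _)).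
  move: (flatten _) => l rk fk; apply/andP; split; last exact: fi.
  rewrite /reduced all_cat; have /andP[-> sv] := rvd; have /andP[-> sl] := rk.
  rewrite /= cat_path last_rcons; move: sv => /= ->.
  case: (l) fk sl => //= q l' qi ->; rewrite andbT /apart /= eq_sym.
  by rewrite qi.
have evpow k : ev (flatten (nseq k (rcons v (i, d)))) = ev (rcons v (i, d)) ^+ k.
  by move: (rcons _ _) => l; elim: k => //= k IHk; rewrite ev_cat IHk -expgS.
case: m m0 {evm} => // m _; rewrite -evpow => /(@ev_inj _ [::]).
by case/andP: (rpow m) => -> _ /(_ isT isT).
Qed.

(** * Standard form of an automorphism *)

(* Up to conjugation by u, f fixes w_1 and maps rho_i to a power of
   rho_(alpha i); when f is an automorphism that power is coprime to t_i. *)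
Definition std f u (alpha : nat -> nat) := f (w 1) = w 1 ^ u /\
  forall i, 2 <= i <= n -> 2 <= alpha i <= n /\ exists k, f (rho i) = (rho (alpha i) ^+ k) ^ u.

Lemma aut_std f : is_aut f -> exists u alpha, std f u alpha.
Proof.
move=> [fM [f' fK f'K]].
have [e [eM ew]] := parity_exists.
have w1_in : 1 <= 1%N <= n by lia.
have e1 : e 1 = false by have := eM 1 1; rewrite mulg1; case: (e 1).
have e_square i (g : W -> W) : monoid_morphism g -> 2 <= i <= n -> e (g (rho i)) = false.
  move=> gM i_in; have [k] := rho_square 1%N i_in; rewrite expg1 => ->.
  by rewrite gM.2 eM addbb.
have eev s : all letter s -> e (ev s) = false.
  elim: s => //= -[i a] s IHs /andP[/andP[/= i_in _] ls].
  rewrite eM IHs // addbF; have [k ->] := rho_square a i_in.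
  by rewrite eM addbb.
(* Otherwise every value of f would be even, against surjectivity. *)
have efw1 : e (f (w 1)).
  apply/negPn/negP => /negbTE efw1; suff: forall y, e (f y) = false.
    by move/(_ (f' (w 1))); rewrite f'K ew.
  elim/gen_ind => [|j y j_in efy]; first by rewrite fM.1.
  rewrite fM.2 eM efy addbF; have [->//|j1] := eqVneq j 1%N.
  by rewrite wE fM.2 eM efw1 e_square //; lia.
have [u fw1] : exists u, f (w 1) = w 1 ^ u.
  have [s [b [rs fE]]] := normal_form (f (w 1)).
  have /reduced_letters ls := rs.
  move: efw1; rewrite fE eM eev //=; case: b fE; last by rewrite e1.
  rewrite expg1 => fE _; apply: palindrome_conj => //.
  (* That ev s w_1 is an involution says that [w 1] inverts [ev s]. *)
  have: f (w 1) * f (w 1) = 1 by rewrite -fM.2 w1w1 fM.1.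
  rewrite fE => ff; apply: inverted_palindrome => //.
  by apply/esym/mulg1_eq; rewrite conjgE w1V -ff !mulgA.
pose g y := f y ^ u^-1.
have gM : monoid_morphism g := mor_comp (morJr _) fM.
have gI : injective g by move=> y z /conjg_inj/(can_inj fK).
have gw1 : g (w 1) = w 1 by rewrite /g fw1 conjgK.
(* The range condition stands under the quantifier so that [choice] yields a total function; 0 is a
   dummy value. *)
have gx i : exists j, 2 <= i <= n -> 2 <= j <= n /\ exists k, g (rho i) = rho j ^+ k.
  have [i_in|_] := boolP (2 <= i <= n); last by exists 0.
  have ti := t_odd i_in.
  have [s [b [rs gE]]] := normal_form (g (rho i)).
  have /reduced_letters ls := rs.
  have := e_square i g gM i_in; rewrite {1}gE eM eev //=.
  case: b gE => [|]; first by rewrite ew.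
  rewrite expg0 mulg1 => gE _.
  have revs : rev s = s.
    apply: inverted_palindrome => //.
    by rewrite -gE -{1}gw1 -(morJ gM) rhoJ // (morV gM).
  have: ev s ^+ t i = 1 by rewrite -gE -(morX gM) rho_torsion // gM.1.
  have t0 : 0 < t i by lia.
  (* At most one letter remains; the empty word would give g(rho_i) = 1, against injectivity. *)
  move/(palindrome_torsion rs revs t0); case: s rs ls gE {revs} => [|[j a] [|//]] rs ls gE.
    by have := rho_neq1 i_in; case; apply: gI; rewrite gE gM.1.
  move=> _; exists j => _; split; first by case/andP: ls => /andP[].
  by exists a; rewrite gE /= mulg1.
have [alpha alphaP] := choice gx.
exists u, alpha; split=> // i /alphaP[ai_in [k gE]]; split=> //.
by exists k; rewrite -gE conjgKV.
Qed.

(** * Composition, uniqueness and inversion of standard forms *)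

Lemma aut_comp f g : @is_aut W f -> is_aut g -> is_aut (f \o g).
Proof. by move=> [fM fB] [gM gB]; split; [apply: mor_comp | apply: bij_comp]. Qed.

Lemma aut_inverse f g : @is_aut W f -> inverse_of f g -> is_aut g.
Proof.
move=> [fM _] [fK gK]; split; last by exists f.
by split=> [|y z]; apply: (can_inj fK); rewrite gK ?fM.1 // fM.2 !gK.
Qed.

Lemma aut_has_inverse f : @is_aut W f -> exists g, inverse_of f g /\ is_aut g.
Proof.
move=> af; have [_ [g fK gK]] := af; exists g; split=> //.
exact: (aut_inverse af).
Qed.

Lemma aut_id : @is_aut W id.
Proof. by split; [split | exists id]. Qed.

Lemma conj_aut u : @is_aut W (conjg ^~ u).
Proof.
split; first exact: morJr.
by exists (conjg ^~ u^-1); [apply: conjgK | apply: conjgKV].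
Qed.

Lemma std_comp f g u v alpha beta : monoid_morphism f -> std f u alpha -> std g v beta ->
  std (f \o g) (u * f v) (alpha \o beta).
Proof.
move=> fM [fw fx] [gw gx]; split; first by rewrite /= gw morJ // fw conjgM.
move=> i /gx[bi_in [k gE]]; have [abi_in [l fE]] := fx _ bi_in; split=> //.
exists (l * k)%N; rewrite /= gE morJ // (morX fM) fE conjgM.
by rewrite expgnA (conjXg (rho _ ^+ l)).
Qed.

(* The retraction of W onto <w_1, rho_j> kills the other rho_i, so nontrivial
   powers of distinct rho_i are not conjugate. *)
Lemma std_uniq f u v alpha beta i : is_aut f -> std f u alpha -> std f v beta ->
  2 <= i <= n -> alpha i = beta i.
Proof.
move=> [fM fB] [_ fa] [_ fb] i_in.
have [ai_in [k fk]] := fa _ i_in; have [bi_in [l fl]] := fb _ i_in.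
apply/eqP/negPn/negP => nab.
pose h j := if j == alpha i then w j else w 1.
have [|r rM rE] := @star_hom W h.
  split=> [j j_in|j j_in]; rewrite /h; first by case: ifP => _; [apply: ww | apply: w1w1].
  rewrite (_ : (1%N == _) = false); last by lia.
  by case: ifP => _; [apply: rho_torsion | rewrite w1w1 expg1n].
have rx j : 2 <= j <= n -> r (rho j) = if j == alpha i then rho j else 1.
  move=> j_in; rewrite rM.2 !rE; try lia.
  rewrite /h (_ : (1%N == _) = false); last by lia.
  by case: ifP; rewrite ?w1w1.
have /(congr1 r) := etrans (esym fk) fl.
rewrite !(morJ rM) !(morX rM) !rx // eqxx eq_sym (negbTE nab) expg1n conj1g.
move/eqP; rewrite conjg_eq1 => /eqP xk1.
case: (rho_neq1 i_in); apply: (bij_inj fB).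
by rewrite fk xk1 conj1g fM.1.
Qed.

Lemma std_id : std id 1 id.
Proof.
split=> [|i i_in]; first by rewrite conjg1.
by split=> //; exists 1%N; rewrite conjg1 expg1.
Qed.

Lemma eq_std f g u alpha : std f u alpha -> f =1 g -> std g u alpha.
Proof. by move=> sf /funext <-. Qed.

Lemma std_inverse f g u v alpha beta i : is_aut f -> inverse_of f g ->
  std f u alpha -> std g v beta -> 2 <= i <= n -> alpha (beta i) = i.
Proof.
move=> [fM _] [_ gK] sf sg.
exact: (std_uniq aut_id (eq_std (std_comp fM sf sg) gK) std_id).
Qed.

(** The order t_i of f(rho_i) divides that of rho_(alpha i); the inverse automorphism gives the
    converse divisibility. *)
Lemma std_torsion f u alpha i : is_aut f -> std f u alpha -> 2 <= i <= n -> t (alpha i) = t i.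
Proof.
move=> af sf i_in.
have dvd_t f' u' alpha' j : is_aut f' -> std f' u' alpha' -> 2 <= j <= n ->
    t j %| t (alpha' j).
  move=> [fM fB] [_ fx] j_in; have [aj_in [k fE]] := fx _ j_in.
  apply: rhoX_eq1 => //; apply: (bij_inj fB).
  rewrite (morX fM) fE fM.1 -conjXg -expgnA mulnC expgnA rho_torsion // expg1n.
  by rewrite conj1g.
have [g [fgV ag]] := aut_has_inverse af; have [v [beta sg]] := aut_std ag.
apply/eqP; rewrite eqn_dvd (dvd_t f u) // andbT.
have gfV : inverse_of g f by case: fgV.
rewrite -[X in _ %| t X](std_inverse ag gfV sg sf i_in).
by apply: (dvd_t g v) => //; have [_ /(_ i i_in)[]] := sf.
Qed.

(** * Diagonal automorphisms and the group C *)

(** The automorphisms of this form are the elements of C, by [diagonal_inC] and [inC_diagonal]. *)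
Definition diagonal f := f (w 1) = w 1 /\
  forall i, 2 <= i <= n -> exists k, f (rho i) = rho i ^+ k.

Lemma diagonal_comp f g : monoid_morphism f -> diagonal f -> diagonal g ->
  diagonal (f \o g).
Proof.
move=> fM [fw fx] [gw gx]; split=> [|i i_in] /=; first by rewrite gw.
have [k ->] := gx i i_in; have [l fE] := fx i i_in.
by exists (l * k)%N; rewrite (morX fM) fE expgnA.
Qed.

(** With d = gcd(k, t_i), f kills rho_i^(t_i/d), so by injectivity t_i divides t_i/d. *)
Lemma coprime_exponent f i k : is_aut f -> 2 <= i <= n -> f (rho i) = rho i ^+ k ->
  coprime k (t i).
Proof.
move=> [fM fB] i_in fE; have ti := t_odd i_in.
have t_gt0 : 0 < t i by lia.
set d := gcdn k (t i); have d_gt0 : 0 < d by rewrite gcdn_gt0 t_gt0 orbT.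
have : t i %| t i %/ d.
  apply: rhoX_eq1 => //; apply: (bij_inj fB); rewrite (morX fM) fE fM.1 -expgnA.
  rewrite muln_divA ?dvdn_gcdr // mulnC -muln_divA ?dvdn_gcdl //.
  by rewrite expgnA rho_torsion // expg1n.
move/dvdn_leq; rewrite divn_gt0 // dvdn_leq ?dvdn_gcdr // => /(_ isT) tle.
have := divn_eq (t i) d; rewrite (eqP (dvdn_gcdr k (t i))) /coprime -/d.
by nia.
Qed.

Lemma inverse_exponent i k : 2 <= i <= n -> coprime k (t i) ->
  exists k', rho i ^+ (k * k') = rho i.
Proof.
move=> i_in ck; have ti := t_odd i_in.
have k_gt0 : 0 < k by case: k ck => //; rewrite /coprime gcd0n; lia.
have [[a b] ab] := coprimeP _ k_gt0 ck; exists a.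
have -> : (k * a = 1 + t i * b)%N by move: ab => /=; lia.
by rewrite expgnDr expgnA rho_torsion // expg1n mulg1.
Qed.

Lemma diagonal_inverse f g : is_aut f -> inverse_of f g -> diagonal f -> diagonal g.
Proof.
move=> af fgV [fw fx]; have [fM _] := af; have [fK gK] := fgV.
split=> [|i i_in]; first by rewrite -[in LHS]fw fK.
have [k fE] := fx i i_in; have ck := coprime_exponent af i_in fE.
have [k' kk'] := inverse_exponent i_in ck; exists k'.
by apply: (can_inj fK); rewrite gK (morX fM) fE -expgnA kk'.
Qed.

Lemma theta_exists i k : 2 <= i <= n -> coprime k (t i) -> exists f,
  [/\ is_aut f, f (w 1) = w 1, f (rho i) = rho i ^+ k
    & forall j, 2 <= j <= n -> j != i -> f (rho j) = rho j].
Proof.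
move=> i_in; pose h l j := if j == i then w 1 * rho i ^+ l else w j.
(* Any exponent l defines an endomorphism; those for k and its inverse modulo t_i are mutually
   inverse. *)
have endo l : exists f, [/\ monoid_morphism f, f (w 1) = w 1, f (rho i) = rho i ^+ l
    & forall j, 2 <= j <= n -> j != i -> f (rho j) = rho j].
  have h1 : h l 1%N = w 1 by rewrite /h (_ : (1%N == i) = false) //; lia.
  have hx j : h l 1%N * h l j = if j == i then rho i ^+ l else rho j.
    by rewrite h1 /h; case: ifP => // _; rewrite mulgA w1w1 mul1g.
  have [|f fM fE] := @star_hom W (h l).
    split=> [j j_in|j j_in].
      rewrite /h; case: ifP => _; last exact: ww.
      rewrite !mulgA -(mulgA (w 1)) -{1}w1V -conjgE conjXg rhoJ // expVgn.
      exact: mulVg.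
    rewrite hx; case: ifP => [/eqP->|_]; last exact: rho_torsion.
    by rewrite -expgnA mulnC expgnA rho_torsion // expg1n.
  have fx j : 2 <= j <= n -> f (rho j) = if j == i then rho i ^+ l else rho j.
    by move=> j_in; rewrite fM.2 !fE ?hx //; lia.
  exists f; split=> //; first by rewrite fE ?h1 //; lia.
    by rewrite fx // eqxx.
  by move=> j j_in /negbTE ji; rewrite fx // ji.
move=> ck; have [k' kk'] := inverse_exponent i_in ck.
have [f [fM fw fx fxj]] := endo k; have [g [gM gw gx gxj]] := endo k'.
exists f; split=> //; split=> //; exists g; apply: star_ext => //=.
- exact: mor_comp.
- by rewrite fw gw.
- move=> j j_in; have [->|ji] := eqVneq j i; last by rewrite fxj // gxj.
  by rewrite fx (morX gM) gx -expgnA mulnC kk'.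
- exact: mor_comp.
- by rewrite gw fw.
- move=> j j_in; have [->|ji] := eqVneq j i; last by rewrite gxj // fxj.
  by rewrite gx (morX fM) fx -expgnA kk'.
Qed.

Lemma diagonal_inC f : is_aut f -> diagonal f -> inC n t w f.
Proof.
(* Induction on the largest index whose rho_i is moved: composing with the inverse of a theta makes
   rho_(m+1) fixed. *)
suff inCm m : forall f, is_aut f -> diagonal f ->
    (forall i, 2 <= i <= n -> m < i -> f (rho i) = rho i) -> inC n t w f.
  by move=> af df; apply: (inCm n) => // i; lia.
elim: m => [|m IHm] {}f af df fxm.
  apply: inC_id; apply: star_ext; rewrite ?df.1 //; first exact: af.1.
  by move=> i i_in; apply: fxm => //; lia.
have [m_in|m_out] := boolP (2 <= m.+1 <= n); last first.
  by apply: IHm => // i i_in mi; apply: fxm => //; lia.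
have [k fE] := df.2 _ m_in; have ck := coprime_exponent af m_in fE.
have [th [ath thw thx thj]] := theta_exists m_in ck.
have [th' [thV ath']] := aut_has_inverse ath; have [thK th'K] := thV.
have thC : inC n t w th.
  have tm := t_odd m_in.
  have ck' : coprime (k %% t m.+1) (t m.+1) by rewrite coprime_modl.
  (* The residue is nonzero since it is coprime to t_(m+1) > 1. *)
  have k'_in : 1 <= k %% t m.+1 < t m.+1.
    rewrite ltn_mod andbC; apply/andP; split; first by lia.
    by case: (k %% _) ck' => //; rewrite /coprime gcd0n; lia.
  apply: (inC_gen m_in k'_in ck'); split=> //; split.
    by rewrite [in LHS]wE ath.1.2 thw thx -/(rho _) expg_mod ?rho_torsion.
  move=> j j_in jm; have [->//|j1] := eqVneq j 1%N.
  by rewrite wE ath.1.2 thw thj //; lia.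
have dth : diagonal th.
  split=> // i i_in; have [->|im] := eqVneq i m.+1; first by exists k.
  by exists 1%N; rewrite thj // expg1.
have d' : diagonal (th' \o f).
  by apply: diagonal_comp df; [case: ath' | apply: diagonal_inverse ath thV dth].
apply: (inC_comp thC (IHm _ (aut_comp ath' af) d' _)) => [i i_in mi|y] /=; last first.
  by rewrite th'K.
have [->|im] := eqVneq i m.+1; first by rewrite fE -thx thK.
have mi' : m.+1 < i by lia.
by rewrite fxm // -[in LHS](thj i i_in im) thK.
Qed.
Lemma inC_diagonal f : inC n t w f -> is_aut f /\ diagonal f.
Proof.
elim=> {f} [i k f i_in _ _ [af [fi fj]]|f f1|f g h _ [af df] _ [ag dg] hE|f g _ [af df] fgV].
- split=> //; have f1 : f (w 1) = w 1 by apply: fj; lia.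
  split=> // j j_in; have [->|ji] := eqVneq j i; last first.
    by exists 1%N; rewrite af.1.2 f1 fj ?expg1 //; lia.
  by exists k; rewrite af.1.2 f1 fi mulgA w1w1 mul1g.
- have -> : f = id by apply/funext.
  split; first exact: aut_id.
  by split=> // i _; exists 1%N.
- have -> : h = f \o g by apply/funext.
  by split; [apply: aut_comp | apply: diagonal_comp; first by case: af].
- by split; [apply: aut_inverse af fgV | apply: diagonal_inverse af fgV df].
Qed.

(** * Inn(W)C as the kernel of f |-> alpha *)

Lemma inInnC_std f : inInnC n t w f -> is_aut f /\ exists u, std f u id.
Proof.
move=> [a [c [[u aE] [/inC_diagonal[ac [cw cx]] fE]]]].
have -> : f = conjg ^~ u \o c by apply/funext => y; rewrite fE /= aE.
split; first exact: (aut_comp (conj_aut u)).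
exists u; split=> [|i i_in] /=; first by rewrite cw.
by split=> //; have [k ->] := cx i i_in; exists k.
Qed.

(** Undoing the conjugation by u leaves a diagonal automorphism. *)
Lemma std_inInnC f u alpha : is_aut f -> std f u alpha ->
  (forall i, 2 <= i <= n -> alpha i = i) -> inInnC n t w f.
Proof.
move=> af [fw fx] alpha1.
exists (conjg ^~ u), (conjg ^~ u^-1 \o f); split; first by exists u.
split; last by move=> y /=; rewrite conjgKV.
apply: diagonal_inC; first exact: (aut_comp (conj_aut _)).
split=> [|i i_in] /=; first by rewrite fw conjgK.
have [_ [k ->]] := fx i i_in; exists k.
by rewrite conjgK alpha1.
Qed.

(** The index maps of a and its inverse cancel around the trivial one of f, as for any kernel. *)
Lemma inInnC_normal : aut_normal (inInnC n t w).
Proof.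
split; last first.
  move=> f a a' /inInnC_std[af [u sf]] aa aV.
  have aa' := aut_inverse aa aV.
  have [v [alpha sa]] := aut_std aa; have [v' [alpha' sa']] := aut_std aa'.
  apply: (std_inInnC _ (std_comp _ (std_comp _ sa sf) sa')) => [|||i i_in] /=.
  - by apply: aut_comp aa'; apply: aut_comp.
  - by apply: mor_comp; [case: aa | case: af].
  - by case: aa.
  exact: (std_inverse aa aV sa sa').
split; first by move=> f /inInnC_std[].
split; first exact: (std_inInnC aut_id std_id).
split=> [f g /inInnC_std[af [u sf]] /inInnC_std[ag [v sg]]|f g /inInnC_std[af [u sf]] fgV].
  exact: (std_inInnC (aut_comp af ag) (std_comp af.1 sf sg)).
have ag := aut_inverse af fgV; have [v [beta sg]] := aut_std ag.
apply: (std_inInnC ag sg) => i i_in.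
exact: (std_inverse af fgV sf sg).
Qed.

(** * Graph automorphisms and the complement *)

Variable ks : seq nat.

Definition same_block i j := blk ks (i - 2) = blk ks (j - 2).

Lemma graph_std f : is_graph_aut n w ks f -> is_aut f /\ exists alpha,
  [/\ std f 1 alpha, (forall i, 2 <= i <= n -> f (w i) = w (alpha i))
    & forall i, 2 <= i <= n -> same_block (alpha i) i].
Proof.
move=> [alpha [alphaP [_ [_ [af [fw fx]]]]]]; split=> //; exists alpha; split=> //.
  split=> [|i i_in]; first by rewrite conjg1.
  have [ai_in _] := alphaP i i_in; split=> //; exists 1%N.
  by rewrite conjg1 expg1 af.1.2 fw fx.
by move=> i /alphaP[].
Qed.

(** The index map of the inverse automorphism inverts alpha, which makes alpha a permutation. *)
Lemma std_graph f u alpha : is_aut f -> f (w 1) = w 1 -> std f u alpha ->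
  (forall i, 2 <= i <= n -> f (w i) = w (alpha i)) ->
  (forall i, 2 <= i <= n -> same_block (alpha i) i) -> is_graph_aut n w ks f.
Proof.
move=> af fw sf fx blkf; have [g [fgV ag]] := aut_has_inverse af.
have [v [beta sg]] := aut_std ag; have gfV : inverse_of g f by case: fgV.
exists alpha; split; first by move=> i i_in; split; [have [_ /(_ i i_in)[]] := sf | apply: blkf].
split=> [i j i_in j_in aij|].
  by rewrite -(std_inverse ag gfV sg sf i_in) aij (std_inverse ag gfV sg sf).
split; last by [].
move=> j j_in; exists (beta j); first by have [_ /(_ j j_in)[]] := sg.
exact: (std_inverse af fgV sf sg).
Qed.

Lemma graph_subgroup : aut_subgroup (is_graph_aut n w ks).
Proof.
split; first by move=> f /graph_std[].
split; first exact: (std_graph aut_id _ std_id).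
split=> [f g|f g gf fgV].
  move=> gf gg; have [af [alpha [sf fx bf]]] := graph_std gf.
  have [ag [beta [sg gx bg]]] := graph_std gg.
  apply: (std_graph (aut_comp af ag) _ (std_comp af.1 sf sg)) => [|i i_in|i i_in] /=.
  - by rewrite sg.1 conjg1 sf.1 conjg1.
  - by rewrite gx // fx //; have [_ /(_ i i_in)[]] := sg.
  - rewrite /same_block bf; last by have [_ /(_ i i_in)[]] := sg.
    exact: bg.
have [af [alpha [sf fx bf]]] := graph_std gf; have [fK gK] := fgV.
have ag := aut_inverse af fgV; have [v [beta sg]] := aut_std ag.
have b_in i : 2 <= i <= n -> 2 <= beta i <= n by move=> i_in; have [_ /(_ i i_in)[]] := sg.
have ab i : 2 <= i <= n -> alpha (beta i) = i.
  by move=> i_in; apply: (std_inverse af fgV sf sg).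
apply: (std_graph ag _ sg) => [|i i_in|i i_in].
- by apply: (can_inj fK); rewrite gK sf.1 conjg1.
- by apply: (can_inj fK); rewrite gK fx ?ab ?b_in.
- by rewrite /same_block -bf ?b_in // ab.
Qed.

(** By uniqueness of the index map, the permutation of such a graph automorphism is the identity. *)
Lemma inInnC_graph_trivial f : inInnC n t w f -> is_graph_aut n w ks f -> f =1 id.
Proof.
move=> /inInnC_std[af [u su]] /graph_std[_ [alpha [sf fx _]]].
apply: presW.2.2 => //; first by case: af.
move=> j j_in; have [->|j1] := eqVneq j 1%N; first by rewrite sf.1 conjg1.
have j_in2 : 2 <= j <= n by lia.
by rewrite fx // -(std_uniq af su sf j_in2).
Qed.

Hypothesis block_torsion : forall i j, 2 <= i <= n -> 2 <= j <= n -> t i = t j ->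
  same_block i j.

(** The assignment of w_(alpha i) to w_i respects the relations, as alpha preserves t; the index map
    of the inverse of f gives its inverse. *)
Lemma graph_exists f u alpha : is_aut f -> std f u alpha ->
  exists2 g, is_graph_aut n w ks g & std g 1 alpha.
Proof.
move=> af sf; have [f' [fV af']] := aut_has_inverse af.
have f'V : inverse_of f' f by case: fV.
have [v [beta sf']] := aut_std af'.
have endo f1 u1 a1 : is_aut f1 -> std f1 u1 a1 -> exists g, [/\ monoid_morphism g,
    g (w 1) = w 1 & forall i, 2 <= i <= n -> g (w i) = w (a1 i)].
  move=> af1 sf1; pose h i := if i == 1%N then w 1 else w (a1 i).
  have a_in i : 2 <= i <= n -> 2 <= a1 i <= n by move=> i_in; have [_ /(_ i i_in)[]] := sf1.
  have hE i : 2 <= i <= n -> h i = w (a1 i) by move=> i_in; rewrite /h; case: eqP => //; lia.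
  have [|g gM gE] := @star_hom W h.
    split=> [j j_in|i i_in].
      rewrite /h; case: eqP => [_|j1]; first exact: w1w1.
      have /a_in aj_in : 2 <= j <= n by lia.
      by apply: ww; lia.
    by rewrite (hE i i_in) -(std_torsion af1 sf1 i_in); apply/rho_torsion/a_in.
  exists g; split=> // [|i i_in]; first by rewrite gE //; lia.
  by rewrite gE ?hE //; lia.
have [g [gM gw gx]] := endo _ _ _ af sf; have [g' [g'M g'w g'x]] := endo _ _ _ af' sf'.
have a_in i : 2 <= i <= n -> 2 <= alpha i <= n by move=> i_in; have [_ /(_ i i_in)[]] := sf.
have b_in i : 2 <= i <= n -> 2 <= beta i <= n by move=> i_in; have [_ /(_ i i_in)[]] := sf'.
have ag : is_aut g.
  split=> //; exists g'; apply: presW.2.2 => [|//|j j_in]; try exact: mor_comp.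
    have [->|j1] := eqVneq j 1%N; first by rewrite /= gw g'w.
    have j_in2 : 2 <= j <= n by lia.
    by rewrite /= gx // g'x ?a_in // (std_inverse af' f'V sf' sf).
  have [->|j1] := eqVneq j 1%N; first by rewrite /= g'w gw.
  have j_in2 : 2 <= j <= n by lia.
  by rewrite /= g'x // gx ?b_in // (std_inverse af fV sf sf').
have sg : std g 1 alpha.
  split=> [|i i_in]; first by rewrite conjg1.
  by split; [apply: a_in | exists 1%N; rewrite conjg1 expg1 gM.2 gw gx].
exists g => //; apply: (std_graph ag gw sg gx) => i i_in.
by apply: block_torsion => //; [apply: a_in | apply: std_torsion af sf i_in].
Qed.

(** If g is the graph automorphism with the index map of f, then f g^-1 has trivial index map. *)
Lemma aut_decomposition f : is_aut f -> exists a g,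
  inInnC n t w a /\ is_graph_aut n w ks g /\ f =1 a \o g.
Proof.
move=> af; have [u [alpha sf]] := aut_std af.
have [g gg sg] := graph_exists af sf; have [ag _] := graph_std gg.
have [g' [gV ag']] := aut_has_inverse ag; have [v [beta sg']] := aut_std ag'.
exists (f \o g'), g; split; last by split=> // y /=; rewrite gV.1.
apply: (std_inInnC (aut_comp af ag') (std_comp af.1 sf sg')) => i i_in.
exact: (std_inverse ag gV sg sg').
Qed.

End StarGroup.

(** * Blocks, and the semidirect decomposition *)

Lemma blk_lt_size ks x : x < sumn ks -> blk ks x < size ks.
Proof. by elim: ks x => //= k ks IHks x lx; case: ifP => // kx; apply: IHks; lia. Qed.

Theorem theorem3p6 (n : nat) (ms ks : seq nat) (W : groupType) (w : nat -> W) :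
  3 <= n ->
  uniq ms -> all (fun m => odd m && (3 <= m)) ms ->
  size ks = size ms -> all (fun k => 0 < k) ks -> sumn ks = n - 1 ->
  is_star_group n (tlab ms ks) w ->
  [/\ aut_normal (inInnC n (tlab ms ks) w),
      aut_subgroup (is_graph_aut n w ks),
      (forall f, inInnC n (tlab ms ks) w f -> is_graph_aut n w ks f -> f =1 id)
    & (forall f, is_aut f -> exists a g, inInnC n (tlab ms ks) w a /\
          is_graph_aut n w ks g /\ f =1 a \o g)].
Proof.
move=> n_gt2 ms_uniq ms_odd size_ks _ sum_ks presW.
have blk_in i : 2 <= i <= n -> blk ks (i - 2) < size ms.
  by move=> i_in; rewrite -size_ks blk_lt_size // sum_ks; lia.
have t_odd i : 2 <= i <= n -> odd (tlab ms ks i) && (2 < tlab ms ks i).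
  by move=> /blk_in i_lt; apply: (allP ms_odd); apply: mem_nth.
(* The m_j are distinct, so t_i determines the block; [blk_in] keeps the default value of [nth] out
   of play. *)
have blk_t i j : 2 <= i <= n -> 2 <= j <= n -> tlab ms ks i = tlab ms ks j ->
    same_block ks i j.
  by move=> /blk_in i_lt /blk_in j_lt /eqP; rewrite nth_uniq // => /eqP.
split.
- exact: (inInnC_normal n_gt2 t_odd presW).
- exact: (graph_subgroup n_gt2 t_odd presW ks).
- exact: (inInnC_graph_trivial n_gt2 t_odd presW).
- exact: (aut_decomposition n_gt2 t_odd presW blk_t).
Qed.
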